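(* Let $q\geq 3$ be an odd prime power. Then $$n(q+1,7)\leq 2q^3+2q^2+q+2.$$
   Context: Graphs are finite and simple. The girth of a graph is the length of its shortest cycle. A $(k,g)$-graph is a $k$-regular graph with girth (exactly) $g$. For $k\ge 2$ and $g\ge 3$, $n(k,g)$ denotes the minimum number of vertices of a $(k,g)$-graph (such graphs exist for all $k\geq 2$, $g\geq 3$ by a theorem of Erdős and Sachs). *)

(* Defs.v *)
From mathcomp Require Import all_boot.

Set Implicit Arguments.
Unset Strict Implicit.
Unset Printing Implicit Defensive.

Record sgraph := SGraph {
  vertex :> finType;
  adj : rel vertex;
  adj_sym : symmetric adj;
  adj_irr : irreflexive adj
}.

(* The closed walks [:: x; y] satisfy ucycle but are not cycles of a simple
   graph, hence the condition on the size. *)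
Definition is_cycle (G : sgraph) (c : seq G) : Prop :=
  ucycle (@adj G) c /\ 3 <= size c.

Definition regular (G : sgraph) (k : nat) : Prop :=
  forall x : G, #|[set y | adj x y]| = k.

(* The girth is a relation: acyclic graphs have no girth. *)
Definition has_girth (G : sgraph) (g : nat) : Prop :=
  (exists2 c : seq G, is_cycle c & size c = g) /\
  (forall c : seq G, is_cycle c -> g <= size c).

Definition kg_graph (k g : nat) (G : sgraph) : Prop :=
  regular G k /\ has_girth G g.

(* is_min_order k g m expresses n(k,g) = m. It is a relation so that a
   claim about n(k,g) never rests on a default value: that the minimum exists
   is part of the claim. *)
Definition is_min_order (k g m : nat) : Prop :=
  (exists2 G : sgraph, kg_graph k g G & #|G| = m) /\
  (forall G : sgraph, kg_graph k g G -> m <= #|G|).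

Definition prime_power (q : nat) : Prop :=
  exists p a : nat, [/\ prime p, 0 < a & q = p ^ a].

(* Main.v *)
Require Import Defs.
From mathcomp Require Import all_boot all_algebra all_field.
From mathcomp Require Import ring zify.
From Stdlib Require Import Classical.

Set Implicit Arguments.
Unset Strict Implicit.
Unset Printing Implicit Defensive.

Import GRing.Theory.

(* The generalized quadrangle W(q) has q^3+q^2+q+1 points and as many lines,
   its incidence graph is (q+1)-regular of girth 8.  We remove q points of a
   hyperbolic line, i.e. q points p_y whose pencils are met by the same q+1
   transversal points: joining each p_y to the t-th transversal point (t in the
   projective line over F_q) names the lines on p_y.  Removing p_y lowers the
   degree of these q+1 lines by one, and we repair this by adding the perfect
   matching M_y of the projective line to them.  Two neighbours of p_y are at
   distance 6 once p_y is gone, so one new edge gives cycles of length at least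
   7; three new edges give cycles of length at least 9; and two new edges, on
   p_y and p_z, lie on a cycle of length 6 only if M_y and M_z share an edge.
   The M_y form the classical 1-factorization of the complete graph on q+1
   vertices, y matched with infinity and k with 2y - k, which exists since q is
   odd. *)

Local Open Scope ring_scope.

(* Points and lines have coordinates in the same type (Hanssens-Van Maldeghem
   coordinates of W(q)): C0 = (oo), C1 a = (a), C2 a b = (a, b), and
   C3 a b c = (a, b, c). *)
Definition cell (F : Type) : Type := unit + F + F * F + F * F * F.

Notation C0 := (inl (inl (inl tt))).
Notation C1 a := (inl (inl (inr a))).
Notation C2 a b := (inl (inr (a, b))).
Notation C3 a b c := (inr (a, b, c)).

Ltac dest := repeat match goal with
  | H : is_true (_ && _) |- _ => move/andP: H => [? ?]
  | H : is_true (_ == _) |- _ => move/eqP: H => H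
  end.

(** * Quadratics and 1-jets: no digons and no triangles in W(q) *)

Section Quadrangle.

Variable F : finFieldType.
Implicit Types p l : cell F.

(* The line [k, b, m] is the quadratic k x^2 + 2 b x + m, and the point (a, y, d)
   is the 1-jet at a of value y and half-derivative d. *)
Definition inc p l : bool :=
  match p, l with
  | C0, C0 | C0, C1 _ | C1 _, C0 => true
  | C1 a, C2 a' _ => a == a'
  | C2 k _, C1 k' => k == k'
  | C2 k b, C3 k' b' _ => (k == k') && (b == b')
  | C3 a y _, C2 a' y' => (a == a') && (y == y')
  | C3 a y d, C3 k b m =>
      (d == a * k + b) && (y == a ^+ 2 * k + 2 * a * b + m)
  | _, _ => false
  end.

(** Equal 1-jets at [a] make the two quadratics differ by (k - k')(x - a)^2; the conclusion compares
    coefficients. *)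
Lemma tangentP (a k b m k' b' m' : F) :
  a * k + b = a * k' + b' ->
  a ^+ 2 * k + 2 * a * b + m = a ^+ 2 * k' + 2 * a * b' + m' ->
  b = b' - a * (k - k') /\ m = m' + a ^+ 2 * (k - k').
Proof.
move=> e1 e2; have eb : b = b' - a * (k - k').
  by rewrite -[LHS](addKr (a * k)) e1; ring.
split=> //; rewrite -[LHS](addKr (a ^+ 2 * k + 2 * a * b)) e2 eb; ring.
Qed.

(** The difference (k - k')(x - a)^2 vanishes at [c] only if a = c or k = k'. *)
Lemma tangent_meet (a c k b m k' b' m' : F) :
  a * k + b = a * k' + b' ->
  a ^+ 2 * k + 2 * a * b + m = a ^+ 2 * k' + 2 * a * b' + m' ->
  c ^+ 2 * k + 2 * c * b + m = c ^+ 2 * k' + 2 * c * b' + m' ->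
  a = c \/ (k, b, m) = (k', b', m').
Proof.
move=> e1 e2 e3; have [eb em] := tangentP e1 e2.
have /eqP : (a - c) * (a - c) * (k - k') = 0.
  apply: (addrI (c ^+ 2 * k' + 2 * c * b' + m')); rewrite addr0 -[in RHS]e3 eb em; ring.
rewrite !mulf_eq0 orbb => /orP[]; rewrite subr_eq0 => /eqP ek; first by left.
by right; rewrite eb em ek subrr !mulr0 subr0 addr0.
Qed.

Lemma inc_digon p q l m :
  inc p l -> inc p m -> inc q l -> inc q m -> p = q \/ l = m.
Proof.
case: l => [[[[]|a]|[a y]]|[[k b] m1]]; case: p => [[[[]|a1]|[k1 b1]]|[[a1 y1] c1]] //=;
case: m => [[[[]|a2]|[a2 y2]]|[[k2 b2] m2]] //=;
case: q => [[[[]|a3]|[k3 b3]]|[[a3 y3] c3]] //= *; dest; subst; do ?[by left | by right].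
- by match goal with H : _ |- _ => move/addrI: H => ->; right end.
- by match goal with H : _ |- _ => move/addrI: H => ->; right end.
- match goal with Hc : a1 * _ + _ = _, Hy : a1 ^+ 2 * _ + _ + _ = _,
    Hc' : a3 * _ + _ = _, Hy' : a3 ^+ 2 * _ + _ + _ = _ |- _ =>
    by case: (tangent_meet Hc Hy Hy') => [->|->]; [left | right] end.
Qed.

Definition triangle p q r l m n :=
  [&& uniq [:: p; q; r], uniq [:: l; m; n],
      inc p l && inc p m, inc q m && inc q n & inc r n && inc r l].

Lemma triangle_rot p q r l m n :
  triangle p q r l m n = triangle q r p m n l.
Proof.
rewrite /triangle -(rot_uniq 1 [:: p; q; r]) -(rot_uniq 1 [:: l; m; n]).
by congr (_ && (_ && _)); rewrite [LHS]andbC -[LHS]andbA.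
Qed.

(** Equal half-derivatives give a(k - k') = b' - b = c(k - k'), hence a^2(k - k') = c^2(k - k'). *)
Lemma parallel_tangent (a c k b m m' k' b' n : F) :
  a * k + b = a * k' + b' ->
  a ^+ 2 * k + 2 * a * b + m = a ^+ 2 * k' + 2 * a * b' + n ->
  c * k + b = c * k' + b' ->
  c ^+ 2 * k + 2 * c * b + m' = c ^+ 2 * k' + 2 * c * b' + n ->
  m = m'.
Proof.
move=> e1 e2 e3 e4; have [eb ->] := tangentP e1 e2.
have [eb' ->] := tangentP e3 e4.
have eac : a * (k - k') = c * (k - k').
  by apply: oppr_inj; apply: (addrI b'); rewrite -eb.
by rewrite !expr2 -!mulrA eac mulrCA eac.
Qed.

Lemma tangent_cycle (a1 a2 a3 k b m k' b' m' k'' b'' m'' : F) :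
  a1 * k + b = a1 * k' + b' ->
  a1 ^+ 2 * k + 2 * a1 * b + m = a1 ^+ 2 * k' + 2 * a1 * b' + m' ->
  a2 * k' + b' = a2 * k'' + b'' ->
  a2 ^+ 2 * k' + 2 * a2 * b' + m' = a2 ^+ 2 * k'' + 2 * a2 * b'' + m'' ->
  a3 * k'' + b'' = a3 * k + b ->
  a3 ^+ 2 * k'' + 2 * a3 * b'' + m'' = a3 ^+ 2 * k + 2 * a3 * b + m ->
  [\/ a1 = a2, a1 = a3 | (k, b, m) = (k', b', m')].
Proof.
move=> e1 e2 e3 e4 e5 e6.
have [eb em] := tangentP e1 e2; have [eb' em'] := tangentP e3 e4.
have [eb'' em''] := tangentP e5 e6.
have s1 : a1 * (k - k') + a2 * (k' - k'') + a3 * (k'' - k) = 0.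
  by apply: (addrI b); rewrite [in LHS]eb eb' eb''; ring.
have s2 : a1 ^+ 2 * (k - k') + a2 ^+ 2 * (k' - k'') + a3 ^+ 2 * (k'' - k) = 0.
  by apply: (addrI (- m)); rewrite [in LHS]em em' em''; ring.
(* For the three differences u_i of leading coefficients, the sums of u_i, a_i u_i and a_i^2 u_i
   vanish; pairing with (x - a2)(x - a3) isolates u_1 = k - k'. *)
have /eqP : (a1 - a2) * (a1 - a3) * (k - k') = 0.
  transitivity (a1 ^+ 2 * (k - k') + a2 ^+ 2 * (k' - k'') + a3 ^+ 2 * (k'' - k)
    - (a2 + a3) * (a1 * (k - k') + a2 * (k' - k'') + a3 * (k'' - k))).
    by ring.
  by rewrite s1 s2 mulr0 subr0.
rewrite !mulf_eq0 !subr_eq0 -orbA => /or3P[] /eqP ek;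
  [by constructor 1 | by constructor 2 | constructor 3].
by rewrite eb em ek subrr !mulr0 subr0 addr0.
Qed.

(** Both quadratics have leading coefficient [a]; being tangent, they coincide. *)
Lemma triangle_C1_C3_C3 p q r a k b m k' b' m' :
  ~~ triangle p q r (C1 a) (C3 k b m) (C3 k' b' m').
Proof.
apply/negP => /and5P[].
case: p => [[[[]|a1]|[k1 b1]]|[[a1 y1] c1]] /=;
case: q => [[[[]|a2]|[k2 b2]]|[[a2 y2] c2]] /=;
case: r => [[[[]|a3]|[k3 b3]]|[[a3 y3] c3]] /=;
  rewrite ?andbF // => Up Ul Hp Hq Hr; simpl in *.
  by move: Up; dest; subst; rewrite !inE eqxx.
case/andP: Hp => /eqP-> /andP[/eqP ka _]; case/andP: Hr => /andP[/eqP k3k' _] /eqP k3a.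
case/andP: Hq => /andP[/eqP-> /eqP->] /andP[/eqP e1 /eqP e2].
have [eb em] := tangentP e1 e2.
by rewrite eb em -ka -k3a k3k' subrr !mulr0 subr0 addr0 !inE eqxx in Ul.
Qed.

(** Both quadratics take the value [y] at [a], so they coincide if they differ by a constant ([q] of
    type [C2]) or are tangent at another place. *)
Lemma triangle_C2_C3_C3 p q r a y k b m k' b' m' :
  ~~ triangle p q r (C2 a y) (C3 k b m) (C3 k' b' m').
Proof.
apply/negP => /and5P[].
case: p => [[[[]|a1]|[k1 b1]]|[[a1 y1] c1]] /=;
case: q => [[[[]|a2]|[k2 b2]]|[[a2 y2] c2]] /=;
case: r => [[[[]|a3]|[k3 b3]]|[[a3 y3] c3]] /=;
  rewrite ?andbF // => Up Ul Hp Hq Hr; simpl in *.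
- move: Ul; dest; subst.
  match goal with e : _ + m' = _ + m |- _ => move/addrI: e => -> end.
  by rewrite !inE eqxx.
- case/andP: Hp => /andP[/eqP ea /eqP ey] /andP[/eqP e1 /eqP e2].
  case/andP: Hr => /andP[_ /eqP e4] /andP[/eqP e5 /eqP e6].
  case/andP: Hq => /andP[/eqP e7 /eqP e8]; rewrite e7 e8 => /andP[/eqP e9 /eqP e10].
  rewrite ea in e1 e2; rewrite e5 in e4.
  case: (tangent_meet (c := a) e9 e10); first by rewrite -e2 -e4 ey e6.
    by move=> e; rewrite ea e1 e2 e7 e8 e !inE eqxx in Up.
  by move=> e; rewrite e !inE eqxx in Ul.
Qed.

(** A point [inl z] on a [C3] line is some [C2 k b], so the first two quadratics differ by a
    constant while both are tangent to the third. *)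
Lemma triangle_C3_parallel z q r k b m k' b' m' k'' b'' m'' :
  ~~ triangle (inl z) q r (C3 k b m) (C3 k' b' m') (C3 k'' b'' m'').
Proof.
apply/negP => /and5P[].
case: z => [[[]|a1]|[k1 b1]] /=;
case: q => [[[[]|a2]|[k2 b2]]|[[a2 y2] c2]] /=;
case: r => [[[[]|a3]|[k3 b3]]|[[a3 y3] c3]] /=;
  rewrite ?andbF // => Up Ul Hp Hq Hr; simpl in *;
  try by move: Up; dest; subst; rewrite !inE eqxx ?andbF.
case/andP: Hq => /andP[/eqP-> /eqP->] /andP[/eqP e1 /eqP e2].
case/andP: Hr => /andP[/eqP-> /eqP->] /andP[/eqP e3 /eqP e4].
case/andP: Hp => /andP[/eqP ek /eqP eb] /andP[/eqP ek' /eqP eb'].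
move: e3 e4; rewrite -ek -eb ek' eb' => e3 e4.
have em := parallel_tangent (esym e3) (esym e4) e1 e2.
by rewrite em -ek -eb ek' eb' !inE eqxx in Ul.
Qed.

Lemma triangle_C3 p q r k b m k' b' m' k'' b'' m'' :
  ~~ triangle p q r (C3 k b m) (C3 k' b' m') (C3 k'' b'' m'').
Proof.
case: p => [z|[[a1 y1] c1]]; first exact: triangle_C3_parallel.
case: q => [z|[[a2 y2] c2]]; first by rewrite triangle_rot triangle_C3_parallel.
case: r => [z|[[a3 y3] c3]]; first by rewrite -triangle_rot triangle_C3_parallel.
apply/negP => /and5P[] /= Up Ul Hp Hq /andP[Hr1 Hr2].
case/andP: Hp => /andP[/eqP e1 /eqP e2]; rewrite e1 e2 => /andP[/eqP e3 /eqP e4].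
case/andP: Hq => /andP[/eqP e5 /eqP e6]; rewrite e5 e6 => /andP[/eqP e7 /eqP e8].
case/andP: Hr1 => /eqP e9 /eqP e10; move: Hr2; rewrite e9 e10 => /andP[/eqP e11 /eqP e12].
case: (tangent_cycle e3 e4 e7 e8 e11 e12) => e.
- by rewrite e1 e2 e3 e4 e5 e6 e !inE eqxx in Up.
- by rewrite e1 e2 e9 e10 e11 e12 e !inE eqxx !orbT in Up.
- by rewrite e !inE eqxx in Ul.
Qed.

(* In all combinations of line types other than the three above, incidence only
   compares coordinates, and the triangle collapses by substitution. *)
Lemma no_triangle p q r l m n : ~~ triangle p q r l m n.
Proof.
apply/negP => T; case/and5P: (T) => /= Up Ul /andP[pl pm] /andP[qm qn] /andP[rn rl].
case: l pl rl Ul T => [[[[]|a1]|[a1 y1]]|[[k1 b1] m1]];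
case: p pm Up => [[[[]|a4]|[k4 b4]]|[[a4 y4] c4]] // pm Up pl;
case: m qm pm => [[[[]|a2]|[a2 y2]]|[[k2 b2] m2]] // qm pm;
case: q Up qn qm => [[[[]|a5]|[k5 b5]]|[[a5 y5] c5]] // Up qn qm;
case: n qn rn => [[[[]|a3]|[a3 y3]]|[[k3 b3] m3]] // qn rn rl Ul T;
case: r Up rn rl T => [[[[]|a6]|[k6 b6]]|[[a6 y6] c6]] // Up rn rl T;
simpl in pl, pm, qm, qn, rn, rl;
try (by move: Up Ul; clear T; dest; subst; rewrite !inE ?eqxx ?andbF ?orbT);
move: T; apply/negP;
first [exact: triangle_C3 | exact: triangle_C1_C3_C3 | exact: triangle_C2_C3_C3 |
  rewrite triangle_rot; exact: triangle_C1_C3_C3 |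
  rewrite triangle_rot; exact: triangle_C2_C3_C3 |
  rewrite -triangle_rot; exact: triangle_C1_C3_C3 |
  rewrite -triangle_rot; exact: triangle_C2_C3_C3].
Qed.

End Quadrangle.

(** * Removed points and the matchings on their pencils *)

Section Graph.

Variable F : finFieldType.
Hypothesis two_neq0 : 2 != 0 :> F.
Implicit Types (p l m n : cell F) (y z : F) (s t : option F).
Let V : finType := (cell F + cell F)%type.
Implicit Types v w : V.

(* The lines on the removed point (0, y, 0); None is the point at infinity of the
   projective line. *)
Definition pencil y t : cell F := if t is Some k then C3 k 0 y else C2 0 y.

Definition partner y t : option F :=
  if t is Some k then if k == y then None else Some (2 * y - k) else Some y.

Lemma partnerK y : involutive (partner y).
Proof.
case=> [k|] /=; last by rewrite eqxx.
case: eqP => [->//|/eqP ky] /=; rewrite ifN; first by congr Some; ring.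
by apply: contra ky => /eqP e; rewrite -[k](subKr (2 * y)) e; apply/eqP; ring.
Qed.

Lemma partner_neq y t : partner y t != t.
Proof.
case: t => [k|] //=; case: (eqVneq k y) => // ky; apply: contra ky => /eqP[e].
by apply/eqP/(mulfI two_neq0); rewrite -[RHS](subrK k) e; ring.
Qed.

(** The matchings are edge-disjoint: the edge at infinity ends in y, any other edge has midpoint y,
    and 2 is invertible. *)
Lemma partner_inj t : injective (partner^~ t).
Proof.
move=> y z; case: t => [k|] /=; last by case.
case: eqP => [<-|_]; case: eqP => [<-|_] // [] /addIr; exact: mulfI.
Qed.

Lemma pencil_inj y : injective (pencil y).
Proof. by move=> [k|] [k'|] // [->]. Qed.

Lemma inc_center y t : inc (C3 0 y 0) (pencil y t).
Proof. by case: t => [k|] /=; rewrite ?expr0n /= ?(mul0r, mulr0, addr0, add0r) !eqxx. Qed.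

(** The removed points (0, y, 0) together with (oo) form the hyperbolic line; every line is kept. *)
Definition kept v : bool := if v is inl (C3 a _ c) then (a, c) != (0, 0) else true.

Lemma keptP p y : kept (inl p) -> p != C3 0 y 0.
Proof. by case: p => [//|[[a y'] c]] /= kp; apply: contra kp => /eqP[-> _ ->]. Qed.

(** The common points are the transversal points [C1 0] and [C2 k 0]: for k distinct from k', the
    quadratics k x^2 + y and k' x^2 + z could be tangent only at 0, where their values differ. *)
Lemma pencil_meet p y z s t : y != z -> inc p (pencil y s) -> inc p (pencil z t) -> s = t.
Proof.
case: p => [[[[]|a]|[k b]]|[[a x] c]]; case: s => [k1|]; case: t => [k2|] //= yz.
- by move=> /andP[/eqP<- _] /andP[/eqP<- _].
- move=> /andP[/eqP-> /eqP->] /andP[/eqP e1 /eqP e2].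
  have [e3 e4] := tangentP e1 e2.
  move/eqP: e3; rewrite eq_sym sub0r oppr_eq0 mulf_eq0 => /orP[/eqP a0|].
    by rewrite e4 a0 expr0n mul0r addr0 eqxx in yz.
  by rewrite subr_eq0 => /eqP->.
- move=> /andP[_ /eqP->] /andP[/eqP-> ].
  by rewrite expr0n /= !(mulr0, mul0r, add0r) (negPf yz).
- move=> /andP[/eqP-> /eqP->] /andP[_ ].
  by rewrite expr0n /= !(mulr0, mul0r, add0r) (negPf yz).
Qed.

Definition mate l m : bool :=
  [exists y, exists t, (l == pencil y t) && (m == pencil y (partner y t))].

Lemma mateP l m :
  reflect (exists y t, l = pencil y t /\ m = pencil y (partner y t)) (mate l m).
Proof.
apply: (iffP existsP) => [[y /existsP[t /andP[/eqP-> /eqP->]]]|[y [t [-> ->]]]].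
  by exists y, t.
by exists y; apply/existsP; exists t; rewrite !eqxx.
Qed.

Lemma mate_sym : symmetric mate.
Proof.
by move=> l m; apply/mateP/mateP => -[y [t [-> ->]]];
  exists y, (partner y t); rewrite partnerK.
Qed.

Lemma mate_irr : irreflexive mate.
Proof.
move=> l; apply/negbTE/negP=> /mateP[y [t [-> /pencil_inj e]]].
by have := partner_neq y t; rewrite -e eqxx.
Qed.

Lemma pencil_param y z s t : pencil y s = pencil z t -> y = z /\ s = t.
Proof. by case: s => [k|]; case: t => [k'|] //= [] // -> ->. Qed.

Lemma mate_uniq l m n : mate l m -> mate l n -> m = n.
Proof.
by move=> /mateP[y [t [-> ->]]] /mateP[z [s [/pencil_param[-> ->] ->]]].
Qed.

(** Mates already share a removed point, so a kept common point would give a digon. *)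
Lemma mate_disjoint l m p : kept (inl p) -> mate l m -> inc p l -> inc p m -> False.
Proof.
move=> kp /mateP[y [t [-> ->]]] pl pm.
case: (inc_digon pl pm (inc_center _ _) (inc_center _ _)) => [e|/pencil_inj e].
  by have := keptP y kp; rewrite e eqxx.
by have := partner_neq y t; rewrite -e eqxx.
Qed.

(** Otherwise the removed point common to [l] and [m] would complete a triangle. *)
Lemma mate_pentagon l m n p q : kept (inl p) -> kept (inl q) -> mate l m ->
  inc p l -> inc p n -> inc q n -> inc q m -> p = q.
Proof.
move=> kp kq lm pl pn qn qm; apply/eqP/negPn/negP => pq.
case/mateP: (lm) => y [t [el em]].
have cl := inc_center y t; have cm := inc_center y (partner y t).
rewrite -el in cl; rewrite -em in cm.
have ln : l != n.
  by apply: contraTneq qm => e; apply/negP; apply: mate_disjoint kq lm _; rewrite e.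
have nm : n != m.
  apply: contraTneq pl => e; apply/negP => pl.
  by apply: mate_disjoint kp lm pl _; rewrite -e.
have lm' : l != m by apply: contraTneq lm => ->; rewrite mate_irr.
have /negP[] := no_triangle p q (C3 0 y 0) l n m.
by rewrite /triangle /uniq !inE !negb_or pq !keptP // ln lm' nm pl pn qn qm cl cm.
Qed.

(** For distinct removed points, [pencil_meet] turns both new edges into one edge shared by two
    matchings. For a single removed point, it would form a digon with [p]. *)
Lemma mate_hexagon l l' m m' p q : kept (inl p) -> kept (inl q) ->
  mate l l' -> mate m m' -> inc p l' -> inc p m -> inc q m' -> inc q l -> l' = m.
Proof.
move=> kp kq /mateP[y [t [-> ->]]] /mateP[z [s [-> ->]]] pl pm qm ql.
case: (eqVneq y z) => [e|yz]; last first.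
  have e1 := pencil_meet yz pl pm; rewrite eq_sym in yz.
  have e2 := pencil_meet yz qm ql.
  case/eqP: yz; apply: (@partner_inj t); rewrite /= e1 -e2.
  by rewrite partnerK.
rewrite -e in pm *; case: (inc_digon pl pm (inc_center _ _) (inc_center _ _)) => // e1.
by have := keptP y kp; rewrite e1 eqxx.
Qed.

(** * Short cycles of the modified graph *)

Definition vadj v w : bool := match v, w with
  | inl p, inr l | inr l, inl p => inc p l
  | inr l, inr m => mate l m
  | inl _, inl _ => false
  end.

Lemma vadj_sym : symmetric vadj.
Proof. by move=> [p|l] [q|m] //=; apply: mate_sym. Qed.

Lemma vadj_irr : irreflexive vadj.
Proof. by move=> [p|l] //=; apply: mate_irr. Qed.

Arguments kept : simpl never.
Arguments inc : simpl never.

Lemma hexagon_free p q r l m n : uniq [:: p; q; r] -> uniq [:: l; m; n] ->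
  inc p l -> inc p m -> inc q m -> inc q n -> inc r n -> inc r l -> False.
Proof.
move=> Up Ul pl pm qm qn rn rl; apply: (negP (no_triangle p q r l m n)).
by rewrite /triangle Up Ul pl pm qm qn rn rl.
Qed.

Ltac clash := by rewrite /= !inE !eqxx ?orbT ?andbF.

(** In order: length 3 with one new edge, two consecutive new edges, length 4 without new edges,
    length 5 with one, length 6 with two. *)
Ltac decide_cycle U :=
  match goal with
  | M : is_true (mate ?l ?m), K : is_true (kept (inl ?p)),
    H : is_true (inc ?p ?l), H' : is_true (inc ?p ?m) |- _ =>
      by case: (mate_disjoint K M H H')
  | M : is_true (mate ?l ?m), M' : is_true (mate ?l ?n) |- _ =>
      move: U; rewrite (mate_uniq M M'); clash
  | H1 : is_true (inc ?p ?l), H2 : is_true (inc ?p ?m),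
    H3 : is_true (inc ?q ?l), H4 : is_true (inc ?q ?m) |- _ =>
      move: U; case: (inc_digon H1 H2 H3 H4) => ->; clash
  | M : is_true (mate ?l ?m),
    K : is_true (kept (inl ?p)), K' : is_true (kept (inl ?q)),
    H1 : is_true (inc ?p ?l), H2 : is_true (inc ?p ?n),
    H3 : is_true (inc ?q ?n), H4 : is_true (inc ?q ?m) |- _ =>
      move: U; rewrite (mate_pentagon K K' M H1 H2 H3 H4); clash
  | M : is_true (mate ?l ?l'), M' : is_true (mate ?m ?m'),
    K : is_true (kept (inl ?p)), K' : is_true (kept (inl ?q)),
    H1 : is_true (inc ?p ?l'), H2 : is_true (inc ?p ?m),
    H3 : is_true (inc ?q ?m'), H4 : is_true (inc ?q ?l) |- _ =>
      move: U; rewrite (mate_hexagon K K' M M' H1 H2 H3 H4); clash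
  end.

Lemma vadj_girth (c : seq V) :
  all kept c -> cycle vadj c -> uniq c -> (2 < size c -> 6 < size c)%N.
Proof.
have ms l m : mate l m -> mate l m && mate m l.
  by move=> lm; rewrite [mate m l]mate_sym lm.
case: c => [|v1 [|v2 [|v3 [|v4 [|v5 [|v6 [|v7 c]]]]]]] //;
  case: v1 => [p1|l1]; case: v2 => [p2|l2] //; case: v3 => [p3|l3] //;
  try (case: v4 => [p4|l4] //); try (case: v5 => [p5|l5] //);
  try (case: v6 => [p6|l6] //);
  rewrite /cycle /rcons /path /vadj ?andbF // => K A U _; exfalso;
  rewrite /= in K A; dest; try done;
  repeat match goal with
    M : is_true (mate _ _) |- _ => move: M => /ms/andP[] end;
  intros; try decide_cycle U.
(* What remains are hexagons alternating between points and lines; the masks extract each kind to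
   show distinctness. *)
all: pose odds := [:: true; false; true; false; true; false].
all: pose evens := [:: false; true; false; true; false; true].
- apply: (@hexagon_free p1 p3 p5 l6 l2 l4) => //.
    by apply: (@map_uniq _ V inl); exact: (mask_uniq U odds).
  rewrite -(rot_uniq 1).
  by apply: (@map_uniq _ V inr); exact: (mask_uniq U evens).
- apply: (@hexagon_free p2 p4 p6 l1 l3 l5) => //.
    by apply: (@map_uniq _ V inl); exact: (mask_uniq U evens).
  by apply: (@map_uniq _ V inr); exact: (mask_uniq U odds).
Qed.

(** * Regularity: neighbours parametrized by the projective line *)

Definition nbr v t : V := match v, t with
  | inl C0, None => inr C0
  | inl C0, Some k => inr (C1 k)
  | inl (C1 a), None => inr C0
  | inl (C1 a), Some y => inr (C2 a y)
  | inl (C2 k b), None => inr (C1 k)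
  | inl (C2 k b), Some m => inr (C3 k b m)
  | inl (C3 a y c), None => inr (C2 a y)
  | inl (C3 a y c), Some k =>
      inr (C3 k (c - a * k) (y - a ^+ 2 * k - 2 * a * (c - a * k)))
  | inr C0, None => inl C0
  | inr C0, Some a => inl (C1 a)
  | inr (C1 k), None => inl C0
  | inr (C1 k), Some b => inl (C2 k b)
  | inr (C2 a y), None => inl (C1 a)
  | inr (C2 a y), Some c =>
      if (a, c) == (0, 0) then inr (C3 y 0 y) else inl (C3 a y c)
  | inr (C3 k b m), None => inl (C2 k b)
  | inr (C3 k b m), Some a =>
      if (a, b) == (0, 0) then inr (pencil m (partner m (Some k)))
      else inl (C3 a (a ^+ 2 * k + 2 * a * b + m) (a * k + b))
  end.

Lemma nbr_inj v : injective (nbr v).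
Proof.
case: v => [[[[[]|a]|[k b]]|[[a y] c]]|[[[[]|k]|[a y]]|[[k b] m]]] [t|] [s|] //=.
all: try by move=> [->].
- case: (eqVneq (a, t) (0, 0)) => [[_ ->]|_];
  case: (eqVneq (a, s) (0, 0)) => [[_ ->]|_] //.
  by case=> ->.
- by case: ifP.
- by case: ifP.
- case: (eqVneq (t, b) (0, 0)) => [[-> _]|_];
  case: (eqVneq (s, b) (0, 0)) => [[-> _]|_] //.
  by case=> ->.
- by case: ifP.
- by case: ifP.
Qed.

(** Where [nbr] would reach a removed point it yields the mate instead; thus [C3 y 0 y] is
    [pencil y (partner y None)]. *)
Lemma nbr_adj v t : kept (nbr v t) && vadj v (nbr v t).
Proof.
have mt y s : mate (pencil y s) (pencil y (partner y s)) by apply/mateP; exists y, s.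
move: v t => [[[[[]|a]|[k b]]|[[a y] c]]|[[[[]|k]|[a y]]|[[k b] m]]] [t|];
rewrite /kept /vadj /inc ?eqxx //= ?eqxx //.
- by apply/andP; split; apply/eqP; ring.
- case: (eqVneq (a, t) (0, 0)) => [[-> _]|at0] /=; last by rewrite at0 !eqxx.
  exact: (mt y None).
- case: (eqVneq (t, b) (0, 0)) => [[_ ->]|tb0] /=; first exact: (mt m (Some k)).
  rewrite !eqxx !andbT; apply: contra tb0 => /eqP[-> /eqP].
  by rewrite mul0r add0r => /eqP->.
Qed.

Lemma adj_nbr v w : kept w -> vadj v w -> exists t, w = nbr v t.
Proof.
case: v => [p|l]; case: w => [q|m] //.
- move=> _; case: p => [[[[]|a]|[k b]]|[[a y] c]];
  case: m => [[[[]|k1]|[a1 y1]]|[[k1 b1] m1]]; rewrite /vadj /inc //;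
  do ?[by exists None | by eexists (Some _) | by move/eqP->; eexists (Some _)].
  + by move/eqP->; exists None.
  + by move=> /andP[/eqP-> /eqP->]; exists (Some m1).
  + by move=> /andP[/eqP-> /eqP->]; exists None.
  move=> /andP[/eqP-> /eqP->]; exists (Some k1) => /=.
  congr (inr (inr (_, _, _))); ring.
- case: l => [[[[]|k]|[a y]]|[[k b] m]];
  case: q => [[[[]|a1]|[k1 b1]]|[[a1 y1] c1]]; rewrite /vadj /inc /kept // => kq;
  do ?[by exists None | by eexists (Some _)].
  + by move/eqP->; exists (Some b1).
  + by move/eqP->; exists None.
  + by move=> /andP[/eqP ea /eqP->]; exists (Some c1); rewrite /= -ea (negPf kq).
  + by move=> /andP[/eqP-> /eqP->]; exists None.
  move=> /andP[/eqP ec /eqP->]; exists (Some a1); rewrite /= -ec ifN //.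
  by apply: contra kq => /eqP[a0 b0]; rewrite ec a0 b0 mul0r add0r.
(* On every line of the pencil, the removed point has parameter 0, which now stands for the mate. *)
- by move=> _ /mateP[y [[k|] [-> ->]]]; exists (Some 0); rewrite /= eqxx.
Qed.

Lemma card_nbr v : #|[set w | kept w && vadj v w]| = #|F|.+1.
Proof.
rewrite -card_option -(card_imset _ (@nbr_inj v)); apply: eq_card => w.
rewrite inE; apply/idP/imsetP => [/andP[kw vw]|[t _ ->]]; last exact: nbr_adj.
by have [t ->] := adj_nbr kw vw; exists t.
Qed.

(** * The graph, its girth and its order *)

Definition sadj : rel {v | kept v} := fun x1 x2 => vadj (val x1) (val x2).
Lemma sadj_sym : symmetric sadj. Proof. by move=> x1 x2; apply: vadj_sym. Qed.
Lemma sadj_irr : irreflexive sadj. Proof. by move=> x1; apply: vadj_irr. Qed.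

Definition graph := SGraph sadj_sym sadj_irr.

Lemma graph_regular : regular graph #|F|.+1.
Proof.
move=> x; rewrite -(card_nbr (val x)) -(card_imset _ val_inj); apply: eq_card => w.
rewrite inE; apply/imsetP/andP => [[y]|[kw xw]].
  by rewrite inE => xy ->; split; first exact: valP.
by exists (exist _ w kw); rewrite ?inE.
Qed.

Lemma graph_girth : has_girth graph 7.
Proof.
split.
  have keep v : kept v -> {u : graph | val u = v} by move=> kv; exists (exist _ v kv).
  (* The new edge between [C3 0 0 0] and [C2 0 0], both on the removed point (0, 0, 0), is closed up
     by a path of length 6 through (oo). *)
  have [u1 e1] := keep (inr (C2 0 0)) isT.
  have [u2 e2] := keep (inl (C1 0)) isT.
  have [u3 e3] := keep (inr C0) isT.
  have [u4 e4] := keep (inl C0) isT.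
  have [u5 e5] := keep (inr (C1 0)) isT.
  have [u6 e6] := keep (inl (C2 0 0)) isT.
  have [u7 e7] := keep (inr (C3 0 0 0)) isT.
  exists [:: u1; u2; u3; u4; u5; u6; u7] => //; split=> //.
  apply/andP; split; last first.
    by rewrite -(map_inj_uniq val_inj) /= e1 e2 e3 e4 e5 e6 e7.
  rewrite /= /sadj e1 e2 e3 e4 e5 e6 e7 /vadj /inc !eqxx !andbT /=.
  by apply/mateP; exists 0, (Some 0); rewrite /= eqxx.
move=> c [/andP[cc uc] c3]; rewrite -(size_map val).
apply: vadj_girth; rewrite ?size_map //.
- by apply/allP => _ /mapP[u _ ->]; apply: valP.
- by rewrite cycle_map.
- by rewrite map_inj_uniq //; apply: val_inj.
Qed.

Lemma card_graph : (#|graph| <= 2 * #|F| ^ 3 + 2 * #|F| ^ 2 + #|F| + 2)%N.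
Proof.
rewrite card_sig.
(* The whole incidence graph has 2(q^3 + q^2 + q + 1) vertices, so for the upper bound it suffices
   that at least q are removed. *)
have del : (#|F| <= #|[predC kept]|)%N.
  rewrite -(@card_imset _ _ (fun y : F => inl (C3 0 y 0) : V)).
  2: by move=> y z [].
  apply/subset_leq_card/subsetP => _ /imsetP[y _ ->].
  by rewrite !inE unfold_in /kept negbK eqxx.
have -> : #|[pred v | kept v]| = #|kept| by apply: eq_card.
have := cardC kept; rewrite !card_sum !card_prod card_unit.
rewrite !expnS expn0 muln1.
move: del; move: #|F| #|kept| #|[predC kept]| => f k d; nia.
Qed.

End Graph.

Local Close Scope ring_scope.

(** Classical logic enters because [P] will be the existence of a graph of a given order, which is a
    proposition and not a boolean. *)
Lemma exists_least (P : nat -> Prop) (n : nat) : P n ->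
  exists2 m, m <= n & P m /\ forall i, P i -> m <= i.
Proof.
elim/ltn_ind: n => n IHn Pn.
case: (classic (exists2 i, i < n & P i)) => [[i lin Pi]|nP].
  by have [m lmi Pm] := IHn i lin Pi; exists m => //; apply: leq_trans lmi (ltnW lin).
exists n => //; split=> // i Pi; rewrite leqNgt; apply/negP => lin.
by apply: nP; exists i.
Qed.

Theorem theorem9 (q : nat) (hq3 : 3 <= q) (hqodd : odd q)
    (hqpp : prime_power q) :
  exists2 m : nat, is_min_order (q + 1) 7 m &
    m <= 2 * q ^ 3 + 2 * q ^ 2 + q + 2.
Proof.
case: hqpp => p [a [pr_p a_gt0 eq]].
have [F pF cF] := PrimePowerField pr_p a_gt0.
rewrite -eq in cF.
have two_neq0 : (2 != 0 :> F)%R.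
  (* If 2 vanished, the characteristic [p] would be 2 and [q] would be even. *)
  apply/negP => two0; have : 2%N \in [pchar F]%R by rewrite inE /= two0.
  rewrite (pcharf_eq pF) => /eqP e.
  by move: hqodd; rewrite eq -e oddX; case: a a_gt0 {eq}.
have kg : kg_graph (q + 1) 7 (graph two_neq0).
  by rewrite /kg_graph addn1 -cF; split; [apply: graph_regular | apply: graph_girth].
have [m le_m [[G kgG cG] minm]] := exists_least
  (P := fun m => exists2 G, kg_graph (q + 1) 7 G & #|G| = m) (ex_intro2 _ _ _ kg erefl).
exists m; last by apply: leq_trans le_m _; rewrite -cF card_graph.
split; first by exists G.
by move=> H kgH; apply: minm; exists H.
Qed.
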